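(* Let $\varepsilon>0$ and let $\psi_n(x,t)$, $n\in\mathbb{Z}_+$, be the free Schrödinger evolution corresponding to the Malmquist–Takenaka system. Then for $x\in\mathbb{R}$ and $t>0$, $$\psi_0(x,t)=\sqrt{\frac{\mathrm{i}}{8\varepsilon t}}\,\exp\!\left(\frac{(2x+\mathrm{i})^2}{16\mathrm{i}\varepsilon t}\right)\operatorname{erfc}\!\left(\frac{2x+\mathrm{i}}{\sqrt{16\mathrm{i}\varepsilon t}}\right),$$ $$\psi_1(x,t)=-\mathrm{i}\,\psi_0(x,t)+(1-2\mathrm{i}x)\,\frac{\psi_0(x,t)-\psi_0(x,0)}{4\varepsilon t},$$ and for every $n\ge1$, $$\mathrm{i}(n+1)\psi_{n+1}=\left(3n+1+\frac{2x+\mathrm{i}}{4\varepsilon t}\right)\psi_n+\mathrm{i}\left(3n-1+\frac{2x-\mathrm{i}}{4\varepsilon t}\right)\psi_{n-1}-(n-1)\psi_{n-2},$$ where $\psi_m=\psi_m(x,t)$ (for $n=1$ the last term is zero).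
   Context: $\mathbb{Z}_+=\{0,1,2,\dots\}$. The Malmquist–Takenaka (MT) functions are $$\varphi_n(x)=\sqrt{\frac{2}{\pi}}\,\mathrm{i}^n\frac{(1+2\mathrm{i}x)^n}{(1-2\mathrm{i}x)^{n+1}},$$ and for $n\in\mathbb{Z}_+$ their free Schrödinger evolution (the solution of $\partial_t\psi_n=-\mathrm{i}\varepsilon\,\partial_x^2\psi_n$, $\psi_n(x,0)=\varphi_n(x)$) is $$\psi_n(x,t)=\frac{(-\mathrm{i})^n}{\sqrt{2\pi}}\int_0^\infty L_n(\xi)\exp\!\left(-\tfrac{\xi}{2}+\mathrm{i}\varepsilon t\xi^2+\mathrm{i}x\xi\right)\mathrm{d}\xi,\qquad n\in\mathbb{Z}_+,$$ where $L_n$ is the $n$th Laguerre polynomial (orthonormal for $\mathrm{e}^{-\xi}\mathrm{d}\xi$ on $[0,\infty)$, $L_n(0)=1$). In particular $\psi_0(x,0)=\varphi_0(x)=\sqrt{2/\pi}\,/(1-2\mathrm{i}x)$. Here $\operatorname{erfc}(z)=\frac{2}{\sqrt\pi}\int_z^\infty \mathrm{e}^{-s^2}\mathrm{d}s$ is the (entire) complementary error function, and square roots are principal. *)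

(* Defs.v *)
From HB Require Import structures.
From mathcomp Require Import all_boot all_order all_algebra.
From mathcomp Require Import all_classical all_reals all_analysis.
From mathcomp Require Import measurable_realfun ring.
From mathcomp Require Export complex.

Set Implicit Arguments.
Unset Strict Implicit.
Unset Printing Implicit Defensive.

Import Order.TTheory GRing.Theory Num.Theory.
Import numFieldNormedType.Exports.

Local Open Scope classical_set_scope.
Local Open Scope ring_scope.

Definition expc {R : realType} (z : R[i]) : R[i] :=
  (expR (complex.Re z))%:C%C * (cos (complex.Im z) +i* sin (complex.Im z))%C.

Definition cintegral0y {R : realType} (f : R -> R[i]) : R[i] :=
  ((\int[@lebesgue_measure R]_(u in `[0%R, +oo[) complex.Re (f u))
   +i* (\int[@lebesgue_measure R]_(u in `[0%R, +oo[) complex.Im (f u)))%C.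

(* [erfc z] is [2 / sqrt pi] times the integral of [exp (- s ^ 2)] from [z] to
   infinity, taken along the horizontal ray [s = z + u], [u >= 0]; the integrand
   is entire and decays towards [+oo] in every horizontal strip. *)
Definition erfc {R : realType} (z : R[i]) : R[i] :=
  (2 / Num.sqrt pi)%:C%C * cintegral0y (fun u => expc (- (z + u%:C%C) ^+ 2)).

(* [size_laguerre], [laguerre_at0] and [laguerre_orthonormal] below check that this
   closed form is the orthonormal system for the weight [exp (- x)] on
   [[0, +oo[], with the normalization [L_n(0) = 1]. *)
Definition laguerre (R : realType) (n : nat) : {poly R} :=
  \poly_(k < n.+1) ((-1) ^+ k * 'C(n, k)%:R / k`!%:R).

Lemma laguerreE (R : realType) n (x : R) :
  (laguerre R n).[x] =
  \sum_(k < n.+1) (-1) ^+ k * 'C(n, k)%:R / k`!%:R * x ^+ k.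
Proof. by rewrite horner_poly. Qed.

Lemma laguerre_at0 (R : realType) n : (laguerre R n).[0] = 1.
Proof.
rewrite laguerreE big_ord_recl /= bin0 fact0 expr0 !mulr1 divr1 big1 ?addr0 //.
by move=> i _; rewrite expr0n mulr0.
Qed.

Lemma size_laguerre (R : realType) n : size (laguerre R n) = n.+1.
Proof.
apply: size_poly_eq; rewrite binn mulr1 mulf_neq0 ?signr_eq0 // invr_eq0.
Qed.

Lemma cvg_expXexpRN (R : realType) k :
  x ^+ k * expR (- x) @[x --> +oo] --> (0 : R).
Proof.
apply: (@squeeze_cvgr _ _ _ _ (fun=> 0) (fun x : R => k.+1`!%:R * x^-1)).
- near=> x; have x0 : 0 < x by near: x; apply: nbhs_pinfty_gt; exact: num_real.
  rewrite mulr_ge0 ?expR_ge0 ?exprn_ge0 ?(ltW x0) //=.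
  rewrite expRN ler_pdivrMr ?expR_gt0 // mulrAC ler_pdivlMr // -exprSr.
  rewrite mulrC -ler_pdivrMr ?ltr0n ?fact_gt0 //.
  by rewrite (le_trans _ (expR_ge1Dxn k (ltW x0))) // lerDr ler01.
- exact: cvg_cst.
- rewrite -(mulr0 k.+1`!%:R); apply: cvgM; first exact: cvg_cst.
  apply/gtr0_cvgV0; last exact: cvg_id.
  by apply: nbhs_pinfty_gt; exact: num_real.
Unshelve. all: by end_near. Qed.

Lemma integral_expXexpRN (R : realType) k :
  (\int[@lebesgue_measure R]_(x in `[0%R, +oo[) (x ^+ k * expR (- x))%:E
   = k`!%:R%:E)%E.
Proof.
pose q : {poly R} := iteri k (fun i (p : {poly R}) => ('X^(i.+1) + i.+1%:R *: p)%R) 1.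
have [qE q0 ql] : [/\ q - q^`() = 'X^k, q.[0] = k`!%:R
    & q.[x] * expR (- x) @[x --> +oo] --> (0 : R)].
  rewrite /q; elim: k {q} => [|k [qE q0 ql]] /=.
    rewrite derivC subr0 hornerC; split=> //.
    have := @cvg_expXexpRN R 0; apply: cvg_trans; apply: near_eq_cvg.
    by near=> x; rewrite hornerC expr0.
  set p := iteri _ _ _ in qE q0 ql *; split.
  - rewrite derivD derivXn derivZ /= opprD addrACA -scalerBr qE.
    by rewrite scaler_nat addrAC -addrA subrr addr0.
  - by rewrite hornerD hornerXn hornerZ q0 expr0n add0r factS natrM.
  - rewrite (_ : (fun x => _) = (fun x : R => x ^+ k.+1 * expR (- x)
      + k.+1%:R * (p.[x] * expR (- x)))); last first.
      by apply/funext => x; rewrite hornerD hornerXn hornerZ mulrDl mulrA.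
    rewrite -[0 in X in _ --> X](addr0 0) -[0 in X in _ --> _ + X](mulr0 k.+1%:R).
    apply: cvgD; first exact: cvg_expXexpRN.
    by apply: cvgM => //; exact: cvg_cst.
have dF (x : R) : is_derive x 1 (fun x => - (q.[x] * expR (- x)))
    (x ^+ k * expR (- x)).
  have := is_deriveN (is_deriveM (is_derive_poly q x)
    (is_derive1_comp (is_derive_expR (- x)) (is_deriveNid x 1))).
  move/is_derive_eq; apply.
  by rewrite -hornerXn -qE hornerD hornerN /GRing.scale /=; ring.
have cf : continuous (fun x : R => x ^+ k * expR (- x)).
  move=> x; apply: cvgM; first exact: exprn_continuous.
  apply: continuous_comp; first exact: opp_continuous.
  exact: continuous_expR.
rewrite (@ge0_continuous_FTC2y _ _ (fun x => - (q.[x] * expR (- x))) _ 0).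
- by rewrite oppr0 expR0 mulr1 q0 EFinN oppeK add0e.
- by move=> x x0; rewrite mulr_ge0 ?expR_ge0 ?exprn_ge0.
- exact: continuous_subspaceT.
- by rewrite -oppr0; exact: cvgN.
- by move=> x _; exact: (@ex_derive _ _ _ _ _ _ _ (dF x)).
- apply: cvg_at_right_filter.
  have /derivable1_diffP/differentiable_continuous :=
    (@ex_derive _ _ _ _ _ _ _ (dF 0)).
  exact.
- by move=> x _; rewrite derive1E; exact: (@derive_val _ _ _ _ _ _ _ (dF x)).
Unshelve. all: by end_near. Qed.

Lemma sum_sign_bin (R : realType) n c j :
  \sum_(k < n.+1) (-1) ^+ k * 'C(n, k)%:R * 'C(k + c, j)%:R
  = (if (n <= j)%N then (-1) ^+ n * 'C(c, j - n)%:R else 0) :> R.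
Proof.
elim: n c j => [|n IHn] c j.
  by rewrite big_ord1 /= expr0 bin0 !mul1r add0n subn0.
have -> : \sum_(k < n.+2) (-1) ^+ k * 'C(n.+1, k)%:R * 'C(k + c, j)%:R
    = \sum_(k < n.+1) (-1) ^+ k * 'C(n, k)%:R * 'C(k + c, j)%:R
    - \sum_(k < n.+1) (-1) ^+ k * 'C(n, k)%:R * 'C(k + c.+1, j)%:R :> R.
  rewrite big_ord_recl /=.
  under eq_bigr => i _ do
    rewrite /bump leq0n add1n binS natrD mulrDr mulrDl.
  rewrite big_split /= addrA; congr (_ + _).
    rewrite [RHS]big_ord_recl /= !bin0; congr (_ + _).
    rewrite big_ord_recr /= bin_small // mulr0 mul0r addr0.
    by apply: eq_bigr => i _; rewrite /bump leq0n add1n.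
  rewrite -sumrN; apply: eq_bigr => i _.
  by rewrite exprS mulN1r !mulNr addnS addSn.
rewrite !IHn; case: j => [|j].
  by case: n {IHn} => [|n] /=; rewrite ?subrr // !sub0n !bin0 subrr.
rewrite ltnS; case: (ltngtP n j.+1) => [nj|nj|->].
- by rewrite -ltnS nj subSS subSn // binS natrD exprS; ring.
- by rewrite leqNgt ltnW // subrr.
- by rewrite ltnn subnn !bin0 subrr.
Qed.

Lemma laguerre_orthonormal (R : realType) m n :
  (\int[@lebesgue_measure R]_(x in `[0%R, +oo[)
     ((laguerre R m).[x] * (laguerre R n).[x] * expR (- x))%:E
   = (m == n)%:R%:E)%E.
Proof.
wlog mn : m n / (m <= n)%N.
  move=> H; have [|/ltnW nm] := leqP m n; first exact: H.
  rewrite eq_sym -(H _ _ nm); apply: eq_integral => x _.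
  by rewrite [X in X * _]mulrC.
pose a m k : R := (-1) ^+ k * 'C(m, k)%:R / k`!%:R.
pose h (p : 'I_m.+1 * 'I_n.+1) (x : R) : \bar R :=
  ((a m p.1 * a n p.2)%:E * (x ^+ (p.1 + p.2) * expR (- x))%:E)%E.
have intX k : (@lebesgue_measure R).-integrable `[0%R, +oo[
    (fun x => (x ^+ k * expR (- x))%:E).
  apply/integrableP; split.
    apply/measurable_EFinP; apply: measurable_funTS.
    apply: continuous_measurable_fun => x.
    apply: cvgM; first exact: exprn_continuous.
    apply: continuous_comp; first exact: opp_continuous.
    exact: continuous_expR.
  rewrite (_ : (\int[_]_(_ in _) _)%E = k`!%:R%:E) ?ltry //.
  rewrite -integral_expXexpRN; apply: eq_integral => x.
  rewrite inE /= in_itv /= andbT => x0.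
  by rewrite ger0_norm // mulr_ge0 ?expR_ge0 ?exprn_ge0.
transitivity (\int[@lebesgue_measure R]_(x in `[0%R, +oo[) (\sum_p h p x))%E.
  apply: eq_integral => x _; rewrite !laguerreE.
  rewrite big_distrlr /= pair_bigA /= mulr_suml -sumEFin.
  apply: eq_bigr => -[i j] _ /=.
  by rewrite /h /= -EFinM exprD /a; congr EFin; ring.
rewrite integral_sum //; last by move=> p; exact: integrableZl.
under eq_bigr => p _ do rewrite integralZl // integral_expXexpRN -EFinM.
rewrite sumEFin; congr EFin.
transitivity (\sum_(i < m.+1) \sum_(j < n.+1) a m i * a n j * (i + j)`!%:R).
  by rewrite pair_bigA.
have fn0 k : k`!%:R != 0 :> R by rewrite pnatr_eq0 -lt0n fact_gt0.
transitivity (\sum_(i < m.+1) (-1) ^+ i * 'C(m, i)%:R * (-1) ^+ n * 'C(i, n)%:R : R).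
  apply: eq_bigr => i _.
  transitivity (a m i * i`!%:R * \sum_(j < n.+1)
      (-1) ^+ j * 'C(n, j)%:R * 'C(j + i, i)%:R).
    rewrite mulr_sumr; apply: eq_bigr => j _.
    rewrite -(@bin_fact (i + j) i) ?leq_addr // addKn [in RHS]addnC /a !natrM.
    by field; rewrite !fn0.
  rewrite sum_sign_bin /a divfK // -!mulrA; congr (_ * (_ * _)).
  case: leqP => [ni|ni]; first by rewrite bin_sub.
  by rewrite bin_small // mulr0.
rewrite big_ord_recr /= big1 ?add0r => [|i _]; last first.
  by rewrite ['C(i, n)]bin_small ?mulr0 // (leq_trans (ltn_ord i)).
rewrite binn mulr1; case: eqVneq => [->|mNn].
  by rewrite binn mulr1 -expr2 sqrr_sign.
by rewrite bin_small ?mulr0 // ltn_neqAle mNn.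
Qed.

(* [psi eps n x t] is the Fourier-integral form of the solution of
   [psi_t = - i eps psi_xx] whose initial value is the n-th Malmquist-Takenaka
   function; [xi] is the frequency. *)
Definition psi {R : realType} (eps : R) (n : nat) (x t : R) : R[i] :=
  (- 'i%C) ^+ n / (Num.sqrt (2 * pi))%:C%C *
  cintegral0y (fun xi => (laguerre R n).[xi]%:C%C *
    expc (- (xi / 2)%:C%C + 'i%C * (eps * t * xi ^+ 2)%:C%C
          + 'i%C * (x * xi)%:C%C)).

(* Main.v *)
Require Import Defs.
From mathcomp Require Import all_boot all_order all_algebra.
From mathcomp Require Import all_classical all_reals all_analysis.
From mathcomp Require Import complex measurable_realfun ring lra.

(** With [a := eps * t], every [psi eps n x t] is a constant times the integral
    over [u >= 0] of [L_n * E], where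
    [E(u) = exp (- u / 2 + i a u^2 + i x u)].  The kernel satisfies
    [E' = (b + 2 i a u) E] with [b = i x - 1/2], and it decays like
    [exp (- u / 2)], so integrating [(p E)'] gives, for every polynomial [p],
    [[
      int p' E + b int p E + 2 i a int u p E = - p(0)
    ]]
    which is [evol_int_parts].  The formula for [psi_1] is the case [p = 1], used
    both at time [t] and at time [0].  The recurrence is the case
    [p = L_n - L_{n-1}]: there [p(0) = 0] and [p' = - L_{n-1}], and two instances
    of the three-term recurrence of the Laguerre polynomials express [u p] as
    the four-term combination of [laguerre_rec4].

    For [psi_0], completing the square gives
    [E(u) = exp (z^2) exp (- (z + w u)^2)], where [z] is the argument of [erfc]
    and [w] is a positive multiple [lam] of [1 - i].  What remains is to turn the
    ray of integration of the Gaussian from the direction [w] to the direction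
    [1], which is [cintegral0y_gauss_turn].  In place of Cauchy's theorem, a path
    of directions [d(th)] joins [1] to [w]; differentiating
    [int d exp (- (z + d u)^2) du] under the integral sign gives the integral of
    the [u]-derivative of [d' u exp (- (z + d u)^2)], which vanishes at both
    ends.  At the end of the path [Re (w^2) = 0] and the quadratic decay is
    lost, but [Re (z w) > 0] leaves a linear decay, and [gauss_exponent_le]
    makes it uniform along the path.

    Complex functions of a real variable are differentiated and integrated
    through their real and imaginary parts, and all integrability follows from
    explicit bounds [C exp (- d u)] on the modulus. *)

Set Implicit Arguments.
Unset Strict Implicit.
Unset Printing Implicit Defensive.

Import Order.TTheory GRing.Theory Num.Theory.
Import numFieldNormedType.Exports.
Import ComplexField.Normc.

Local Open Scope classical_set_scope.
Local Open Scope ring_scope.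
Local Notation Re := complex.Re.
Local Notation Im := complex.Im.
Local Notation normc := ComplexField.Normc.normc.

(** * Complex numbers through real and imaginary parts *)

Section ComplexAlgebra.
Context {R : realType}.
Implicit Types (z w : R[i]) (r : R).

Lemma cReM z w : Re (z * w) = Re z * Re w - Im z * Im w.
Proof. by case: z => a b; case: w => c d. Qed.

Lemma cImM z w : Im (z * w) = Re z * Im w + Im z * Re w.
Proof. by case: z => a b; case: w => c d. Qed.

Lemma cReD z w : Re (z + w) = Re z + Re w.
Proof. by case: z => a b; case: w => c d. Qed.

Lemma cImD z w : Im (z + w) = Im z + Im w.
Proof. by case: z => a b; case: w => c d. Qed.

Lemma complex_eqP z w : Re z = Re w -> Im z = Im w -> z = w.
Proof. by case: z => a b; case: w => c d /= -> ->. Qed.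

Lemma expcD z w : expc (z + w) = expc z * expc w.
Proof.
rewrite /expc cReD cImD expRD cosD sinD.
apply: complex_eqP; rewrite !(cReM, cImM) /=; ring.
Qed.

Lemma expc0 : expc 0 = 1 :> R[i].
Proof. by rewrite /expc /= expR0 cos0 sin0 mul1r. Qed.

Lemma normc_ge0 z : 0 <= normc z.
Proof. by case: z => a b; exact: sqrtr_ge0. Qed.

Lemma normc_expc z : normc (expc z) = expR (Re z).
Proof.
rewrite /expc /= mul0r subr0 mul0r addr0 /=.
by rewrite !exprMn -mulrDr cos2Dsin2 mulr1 sqrtr_sqr ger0_norm ?expR_ge0.
Qed.

Lemma normc_real r : normc r%:C%C = `|r|.
Proof. by rewrite /= expr0n addr0 sqrtr_sqr. Qed.

Lemma Re_le_normc z : `|Re z| <= normc z.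
Proof. by case: z => a b /=; rewrite -sqrtr_sqr ler_wsqrtr // lerDl sqr_ge0. Qed.

Lemma Im_le_normc z : `|Im z| <= normc z.
Proof. by case: z => a b /=; rewrite -sqrtr_sqr ler_wsqrtr // lerDr sqr_ge0. Qed.

(** For a nonnegative multiple of [i] the principal root lies on the ray of
    argument [pi / 4]. *)
Lemma sqrtc_imag r : 0 <= r ->
  sqrtc (r%:C%C * 'i%C) = (Num.sqrt (r / 2))%:C%C * (1 + 'i%C).
Proof.
move=> r0; rewrite /sqrtc /=.
have -> : r * 0 - 0 * 1 = 0 by ring.
have -> : r * 1 + 0 * 0 = r by ring.
rewrite expr0n add0r sqrtr_sqr ger0_norm // subr0 addr0.
have -> : (if r == 0 then 1 else Num.sg r) * Num.sqrt (r / 2) = Num.sqrt (r / 2).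
  case: eqVneq => [_|rn0]; first by rewrite mul1r.
  by rewrite gtr0_sg ?mul1r // lt_neqAle eq_sym rn0.
by apply: complex_eqP; rewrite !(cReM, cImM, cReD, cImD) /=; ring.
Qed.

End ComplexAlgebra.

(** * Differentiating a complex function of a real variable *)

Section ComplexDerivative.
Context {R : realType}.
Implicit Types (f g : R -> R[i]) (x : R).

Definition is_cderive f x (l : R[i]) :=
  is_derive x 1 (fun u => Re (f u)) (Re l) /\
  is_derive x 1 (fun u => Im (f u)) (Im l).

Lemma is_cderive_eq f x l l' : is_cderive f x l -> l = l' -> is_cderive f x l'.
Proof. by move=> h <-. Qed.

Lemma is_cderive_cst x (c : R[i]) : is_cderive (fun=> c) x 0.
Proof. by split; exact: is_derive_cst. Qed.

Lemma is_cderive_real (g : R -> R) x dg :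
  is_derive x 1 g dg -> is_cderive (fun u => (g u)%:C%C) x dg%:C%C.
Proof. by move=> h; split => //=; exact: is_derive_cst. Qed.

Lemma is_cderiveD f g x df dg : is_cderive f x df -> is_cderive g x dg ->
  is_cderive (fun u => f u + g u) x (df + dg).
Proof.
move=> [f1 f2] [g1 g2]; split.
  rewrite cReD (_ : (fun u => _) = (fun u => Re (f u) + Re (g u))).
    exact: is_deriveD.
  by apply/funext => u; rewrite cReD.
rewrite cImD (_ : (fun u => _) = (fun u => Im (f u) + Im (g u))).
  exact: is_deriveD.
by apply/funext => u; rewrite cImD.
Qed.

Lemma is_cderiveM f g x df dg : is_cderive f x df -> is_cderive g x dg ->
  is_cderive (fun u => f u * g u) x (df * g x + f x * dg).
Proof.
move=> [f1 f2] [g1 g2]; split.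
  rewrite (_ : (fun u => _) =
      (fun u => Re (f u) * Re (g u) - Im (f u) * Im (g u))); last first.
    by apply/funext => u; rewrite cReM.
  apply: is_derive_eq; rewrite cReD !cReM /GRing.scale /=; ring.
rewrite (_ : (fun u => _) =
    (fun u => Re (f u) * Im (g u) + Im (f u) * Re (g u))); last first.
  by apply/funext => u; rewrite cImM.
apply: is_derive_eq; rewrite cImD !cImM /GRing.scale /=; ring.
Qed.

Lemma is_cderive_expc f x df : is_cderive f x df ->
  is_cderive (fun u => expc (f u)) x (df * expc (f x)).
Proof.
move=> [f1 f2].
have e1 := is_derive1_comp (is_derive_expR (Re (f x))) f1.
have c1 := is_derive1_comp (is_derive_cos (Im (f x))) f2.
have s1 := is_derive1_comp (is_derive_sin (Im (f x))) f2.
split.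
  rewrite (_ : (fun u => _) =
      (fun u => (expR \o (fun v => Re (f v))) u
                * (cos \o (fun v => Im (f v))) u)); last first.
    by apply/funext => u /=; rewrite mul0r subr0.
  apply: is_derive_eq; rewrite /expc !(cReM, cImM) /GRing.scale /=; ring.
rewrite (_ : (fun u => _) =
    (fun u => (expR \o (fun v => Re (f v))) u
              * (sin \o (fun v => Im (f v))) u)); last first.
  by apply/funext => u /=; rewrite mul0r addr0.
apply: is_derive_eq; rewrite /expc !(cReM, cImM) /GRing.scale /=; ring.
Qed.

Definition ccontinuous f :=
  continuous (fun u => Re (f u)) /\ continuous (fun u => Im (f u)).

Lemma is_cderive_ccontinuous f f' :
  (forall x, is_cderive f x (f' x)) -> ccontinuous f.
Proof.
move=> h; split=> x; apply: differentiable_continuous;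
  apply/derivable1_diffP; have [[d1 _] [d2 _]] := h x; [exact: d1|exact: d2].
Qed.

End ComplexDerivative.

(** * Exponentially decaying functions on the half-line *)

Section HalfLine.
Context {R : realType}.
Implicit Types (f g : R -> R[i]) (h H : R -> R).
Let mu := @lebesgue_measure R.

Lemma cvg_expR_decay (C d : R) : 0 < d ->
  C * expR (- (d * u)) @[u --> +oo] --> (0 : R).
Proof.
move=> d0; rewrite -(mulr0 C); apply: cvgM; first exact: cvg_cst.
apply: (@squeeze_cvgr _ _ _ _ (fun=> 0) (fun u : R => d^-1 * u^-1)).
- near=> u; have u0 : 0 < u by near: u; apply: nbhs_pinfty_gt; exact: num_real.
  have du0 : 0 < d * u by rewrite mulr_gt0.
  rewrite expR_ge0 /= expRN -invfM lef_pV2 ?posrE ?expR_gt0 //.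
  by rewrite (le_trans _ (expR_ge1Dx _)) // lerDr ler01.
- exact: cvg_cst.
- rewrite -(mulr0 d^-1); apply: cvgM; first exact: cvg_cst.
  apply/gtr0_cvgV0; last exact: cvg_id.
  by apply: nbhs_pinfty_gt; exact: num_real.
Unshelve. all: by end_near. Qed.

Lemma is_derive_expR_lin (d u : R) :
  is_derive u 1 (fun u => expR (- (d * u))) (- d * expR (- (d * u))).
Proof.
have h : is_derive u 1 (fun u : R => - (d * u)) (- d).
  by apply: is_derive_eq; rewrite /GRing.scale /= mulr1.
have := @is_derive1_comp _ expR (fun u => - (d * u)) _ _ _ (is_derive_expR _) h.
by move/is_derive_eq; apply; rewrite mulrC.
Qed.

Lemma continuous_expR_lin (d : R) : continuous (fun u => expR (- (d * u))).
Proof.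
move=> u; apply: differentiable_continuous; apply/derivable1_diffP.
by have [] := is_derive_expR_lin d u.
Qed.

Lemma Rintegral_FTC_ge0 h H : (forall u, 0 <= u -> 0 <= h u) -> continuous h ->
  (forall u : R, is_derive u 1 H (h u)) -> H u @[u --> +oo] --> 0 ->
  mu.-integrable `[0, +oo[ (EFin \o h) /\
  \int[mu]_(u in `[0, +oo[) h u = - H 0.
Proof.
move=> h0 ch dH Hl.
have E : (\int[mu]_(u in `[0%R, +oo[) (h u)%:E = (- H 0)%:E)%E.
  rewrite (@ge0_continuous_FTC2y _ h H 0 0) ?sub0e //.
  - exact: continuous_subspaceT.
  - apply: cvg_at_right_filter.
    apply: differentiable_continuous; apply/derivable1_diffP.
    by have [] := dH 0.
  - by move=> u _; rewrite derive1E; have [_ ->] := dH u.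
split; last by rewrite /Rintegral E.
apply/integrableP; split.
  apply/measurable_EFinP; apply: measurable_funTS.
  exact: continuous_measurable_fun.
rewrite (_ : (\int[_]_(_ in _) _)%E = (- H 0)%:E) ?ltry // -E.
apply: eq_integral => u; rewrite inE /= in_itv /= andbT => u0.
by rewrite ger0_norm // h0.
Qed.

Lemma expR_decay_integrable (C d : R) : 0 <= C -> 0 < d ->
  mu.-integrable `[0, +oo[ (EFin \o (fun u => C * expR (- (d * u)))) /\
  \int[mu]_(u in `[0, +oo[) (C * expR (- (d * u))) = C / d.
Proof.
move=> C0 d0.
have -> : C / d = - (- (C / d) * expR (- (d * 0))).
  by rewrite mulr0 oppr0 expR0 mulr1 opprK.
apply: (Rintegral_FTC_ge0 (H := fun u => - (C / d) * expR (- (d * u)))).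
- by move=> u _; rewrite mulr_ge0 ?expR_ge0.
- move=> u; apply: cvgM; first exact: cvg_cst.
  exact: continuous_expR_lin.
- move=> u; have h := is_derive_expR_lin d u; apply: is_derive_eq.
  by rewrite /GRing.scale /=; field; rewrite gt_eqF.
- exact: cvg_expR_decay.
Qed.

Lemma integrable_exp_dominated h (C d : R) : 0 <= C -> 0 < d -> continuous h ->
  (forall u, 0 <= u -> `|h u| <= C * expR (- (d * u))) ->
  mu.-integrable `[0, +oo[ (EFin \o h).
Proof.
move=> C0 d0 ch hb.
apply: le_integrable (expR_decay_integrable C0 d0).1 => //.
  apply/measurable_EFinP; apply: measurable_funTS.
  exact: continuous_measurable_fun.
move=> u /=; rewrite in_itv /= andbT => u0.
by rewrite lee_fin (le_trans (hb u u0)) // ler_norm.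
Qed.

(** Adding the dominating function [C * expR (- (d * u))], whose integral is
    known, makes the integrand nonnegative and reduces the signed case to
    [Rintegral_FTC_ge0]. *)
Lemma Rintegral_FTC h H (C d : R) : 0 <= C -> 0 < d -> continuous h ->
  (forall u, 0 <= u -> `|h u| <= C * expR (- (d * u))) ->
  (forall u : R, is_derive u 1 H (h u)) -> H u @[u --> +oo] --> 0 ->
  \int[mu]_(u in `[0, +oo[) h u = - H 0.
Proof.
move=> C0 d0 ch hb dH Hl.
have [Ie Ee] := expR_decay_integrable C0 d0.
have Ih := integrable_exp_dominated C0 d0 ch hb.
have [_] : mu.-integrable `[0, +oo[ (EFin \o (fun u => h u + C * expR (- (d * u)))) /\
  \int[mu]_(u in `[0, +oo[) (h u + C * expR (- (d * u)))
   = - (H 0 + - (C / d) * expR (- (d * 0))).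
  apply: (Rintegral_FTC_ge0 (H := fun u => H u + - (C / d) * expR (- (d * u)))).
  - move=> u u0; have := hb u u0; rewrite ler_norml => /andP[+ _].
    by rewrite -subr_ge0 opprK.
  - move=> u; apply: cvgD; first exact: ch.
    apply: cvgM; first exact: cvg_cst.
    exact: continuous_expR_lin.
  - move=> u; have h1 := dH u; have h2 := is_derive_expR_lin d u.
    apply: is_derive_eq.
    by rewrite /GRing.scale /=; field; rewrite gt_eqF.
  - rewrite -(addr0 0); apply: cvgD => //; exact: cvg_expR_decay.
rewrite RintegralD // Ee mulr0 oppr0 expR0 mulr1 opprD opprK.
by move/addIr.
Qed.

(** Membership in this class is the only growth condition used on integrands:
    it gives integrability and kills boundary terms at infinity, and it is
    stable under multiplication by functions of polynomial growth. *)
Definition exp_decay f := exists C d,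
  [/\ 0 <= C, 0 < d & forall u, 0 <= u -> normc (f u) <= C * expR (- (d * u))].

Definition cintegrable f :=
  mu.-integrable `[0, +oo[ (EFin \o (fun u => Re (f u))) /\
  mu.-integrable `[0, +oo[ (EFin \o (fun u => Im (f u))).

Lemma exp_decay_cintegrable f : ccontinuous f -> exp_decay f -> cintegrable f.
Proof.
move=> [c1 c2] [C [d [C0 d0 fb]]]; split;
  apply: (integrable_exp_dominated C0 d0) => // u u0; apply: le_trans (fb u u0).
  exact: Re_le_normc.
exact: Im_le_normc.
Qed.

Lemma eq_cintegral0y f g : f =1 g -> cintegral0y f = cintegral0y g.
Proof. by move=> /funext ->. Qed.

Lemma cintegral0yD f g : cintegrable f -> cintegrable g ->
  cintegral0y (fun u => f u + g u) = cintegral0y f + cintegral0y g.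
Proof.
move=> [f1 f2] [g1 g2]; rewrite /cintegral0y.
under eq_Rintegral do rewrite cReD.
under [in X in (_ +i* X)%C]eq_Rintegral do rewrite cImD.
by rewrite !RintegralD.
Qed.

Lemma cintegral0yZ (c : R[i]) f : cintegrable f ->
  cintegral0y (fun u => c * f u) = c * cintegral0y f.
Proof.
move=> [f1 f2]; rewrite /cintegral0y.
under eq_Rintegral do rewrite cReM.
under [in X in (_ +i* X)%C]eq_Rintegral do rewrite cImM.
have intZ k h : mu.-integrable `[0, +oo[ (EFin \o h) ->
    mu.-integrable `[0, +oo[ (EFin \o (fun u => k * h u)).
  by move=> ih; apply: (integrableZl _ k ih).
rewrite RintegralB; [|by []|exact: intZ|exact: intZ].
rewrite RintegralD; [|by []|exact: intZ|exact: intZ].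
rewrite !RintegralZl //.
by apply: complex_eqP; rewrite !(cReM, cImM).
Qed.

Lemma cintegral0y_FTC f F : ccontinuous f -> exp_decay f -> exp_decay F ->
  (forall u, is_cderive F u (f u)) -> cintegral0y f = - F 0.
Proof.
move=> [c1 c2] [C [d [C0 d0 fb]]] [C' [d' [C0' d0' Fb]]] dF.
have F0 (H : R -> R) : (forall u, `|H u| <= normc (F u)) -> H u @[u --> +oo] --> 0.
  move=> HF; apply: norm_cvg0.
  apply: (@squeeze_cvgr _ _ _ _ (fun=> 0) (fun u : R => C' * expR (- (d' * u)))).
  - near=> u; have u0 : 0 <= u.
      by near: u; apply: nbhs_pinfty_ge; exact: num_real.
    by rewrite normr_ge0 /= (le_trans (HF u)) ?Fb.
  - exact: cvg_cst.
  - exact: cvg_expR_decay.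
have ERe : \int[mu]_(u in `[0, +oo[) Re (f u) = - Re (F 0).
  apply: (Rintegral_FTC C0 d0 c1 (H := fun u => Re (F u))).
  - by move=> u u0; apply: le_trans (fb u u0); exact: Re_le_normc.
  - by move=> u; have [] := dF u.
  - by apply: F0 => u; exact: Re_le_normc.
have EIm : \int[mu]_(u in `[0, +oo[) Im (f u) = - Im (F 0).
  apply: (Rintegral_FTC C0 d0 c2 (H := fun u => Im (F u))).
  - by move=> u u0; apply: le_trans (fb u u0); exact: Im_le_normc.
  - by move=> u; have [] := dF u.
  - by apply: F0 => u; exact: Im_le_normc.
by rewrite /cintegral0y ERe EIm; case: (F 0).
Unshelve. all: by end_near. Qed.

(** The derivative of the integral with respect to the parameter is the
    integral of [h' s], which is zero by hypothesis; a domination that does not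
    depend on [s] allows differentiating under the integral sign. *)
Lemma Rintegral_param_const (h h' : R -> R -> R) (C d : R) :
  0 <= C -> 0 < d ->
  (forall s, mu.-integrable `[0, +oo[ (EFin \o h s)) ->
  (forall s u : R, is_derive s 1 (h ^~ u) (h' s u)) ->
  (forall s u, 0 <= u -> `|h' s u| <= C * expR (- (d * u))) ->
  (forall s, \int[mu]_(u in `[0, +oo[) h' s u = 0) ->
  forall a b,
  \int[mu]_(u in `[0, +oo[) h a u = \int[mu]_(u in `[0, +oo[) h b u.
Proof.
move=> C0 d0 ih dh hb h'0 a b.
pose F s := \int[mu]_(u in `[0, +oo[) h s u.
have d1 s u : partial1of2 h s u = h' s u.
  by rewrite partial1of2E; have [_ ->] := dh s u.
have dF (s : R) : is_derive s 1 F 0.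
  have sI : `](s - 1), (s + 1)[%classic s.
    by rewrite /= in_itv /=; apply/andP; split; lra.
  have G0 u : 0 <= C * expR (- (d * u)) by rewrite mulr_ge0 ?expR_ge0.
  have Gub x u : `](s - 1), (s + 1)[%classic x -> `[0, +oo[%classic u ->
      `|partial1of2 h x u| <= C * expR (- (d * u)).
    by move=> _ /=; rewrite in_itv /= andbT => u0; rewrite d1 hb.
  have dh1 x u : `](s - 1), (s + 1)[%classic x -> `[0, +oo[%classic u ->
      derivable (h ^~ u) x 1 by move=> _ _; have [] := dh x u.
  have IG := (expR_decay_integrable C0 d0).1.
  have mI := measurable_itv (Interval (BLeft (0:R)) +oo%O).
  apply: DeriveDef.
    exact: (@derivable_under_integral R _ _ mu h _ mI _ _ _ sI
      (fun x _ => ih x) dh1 _ G0 IG Gub).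
  rewrite -derive1E (@differentiation_under_integral R _ _ mu h _ mI _ _ _ sI
      (fun x _ => ih x) dh1 _ G0 IG Gub).
  by rewrite -[RHS](h'0 s); apply: eq_Rintegral => u _; exact: d1.
exact: (is_derive_0_is_cst _ _ dF).
Qed.

Lemma cintegral0y_param_const (f f' : R -> R -> R[i]) (C d : R) :
  0 <= C -> 0 < d ->
  (forall s, cintegrable (f s)) ->
  (forall s u, is_cderive (f ^~ u) s (f' s u)) ->
  (forall s u, 0 <= u -> normc (f' s u) <= C * expR (- (d * u))) ->
  (forall s, cintegral0y (f' s) = 0) ->
  forall a b, cintegral0y (f a) = cintegral0y (f b).
Proof.
move=> C0 d0 fi df fb f0 a b; rewrite /cintegral0y.
congr (_ +i* _)%C.
- apply: (Rintegral_param_const (h := fun s u => Re (f s u))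
    (h' := fun s u => Re (f' s u)) C0 d0).
  + by move=> s; have [] := fi s.
  + by move=> s u; have [] := df s u.
  + by move=> s u u0; apply: le_trans (fb s u u0); exact: Re_le_normc.
  + by move=> s; have [] := f0 s.
- apply: (Rintegral_param_const (h := fun s u => Im (f s u))
    (h' := fun s u => Im (f' s u)) C0 d0).
  + by move=> s; have [] := fi s.
  + by move=> s u; have [] := df s u.
  + by move=> s u u0; apply: le_trans (fb s u u0); exact: Im_le_normc.
  + by move=> s; have [] := f0 s.
Qed.

Lemma expR_dominates_pow (k : nat) (e : R) : 0 < e ->
  exists C, 0 <= C /\ forall u, 0 <= u -> (1 + u) ^+ k <= C * expR (e * u).
Proof.
move=> e0.
(* From y ^+ k.+1 / k.+1`! <= expR y at y = e * (1 + u). *)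
exists (expR e * (k.+1`!%:R / e ^+ k.+1)).
split; first by rewrite mulr_ge0 ?expR_ge0 // divr_ge0 ?exprn_ge0 // ltW.
move=> u u0.
have h := @expR_ge1Dxn R (e * (1 + u)) k (mulr_ge0 (ltW e0) (addr_ge0 ler01 u0)).
have : (e * (1 + u)) ^+ k.+1 / k.+1`!%:R <= expR (e * (1 + u)).
  by apply: le_trans h; rewrite lerDr ler01.
rewrite (_ : expR (e * (1 + u)) = expR e * expR (e * u)); last first.
  by rewrite mulrDr mulr1 expRD.
rewrite ler_pdivrMr ?ltr0n ?fact_gt0 // exprMn.
rewrite mulrC -ler_pdivlMr ?exprn_gt0 // => h2.
apply: (@le_trans _ _ ((1 + u) ^+ k.+1)).
  by rewrite exprS ler_peMl ?exprn_ge0 // ?lerDl // addr_ge0.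
by apply: le_trans h2 _; rewrite le_eqVlt; apply/orP; left; apply/eqP; ring.
Qed.

(** Half of the exponential rate pays for the polynomial factor. *)
Lemma exp_decayM (p f : R -> R[i]) (A : R) (k : nat) :
  (forall u, 0 <= u -> normc (p u) <= A * (1 + u) ^+ k) ->
  exp_decay f -> exp_decay (fun u => p u * f u).
Proof.
move=> pb [C [d [C0 d0 fb]]].
have d20 : 0 < d / 2 by rewrite divr_gt0.
have [K [K0 hK]] := expR_dominates_pow k d20.
have A0 : 0 <= A.
  have := pb 0 (lexx 0); rewrite addr0 expr1n mulr1.
  by apply: le_trans; exact: normc_ge0.
exists (A * K * C), (d / 2); split=> //; first by rewrite !mulr_ge0.
move=> u u0; rewrite ComplexField.Normc.normcM.
apply: le_trans (ler_pM (normc_ge0 _) (normc_ge0 _) (pb u u0) (fb u u0)) _.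
have -> : - (d * u) = d / 2 * u * (-1) * 2 by field.
apply: (@le_trans _ _ (A * (K * expR (d / 2 * u)) * (C * expR (d / 2 * u * -1 * 2)))).
  rewrite ler_wpM2r ?mulr_ge0 ?expR_ge0 // ler_wpM2l //; exact: hK.
rewrite le_eqVlt; apply/orP; left; apply/eqP.
have -> : expR (- (d / 2 * u)) = expR (d / 2 * u) * expR (d / 2 * u * -1 * 2).
  by rewrite -expRD; congr expR; ring.
by ring.
Qed.

Lemma exp_decayZ (c : R[i]) f : exp_decay f -> exp_decay (fun u => c * f u).
Proof.
by apply: (@exp_decayM (fun=> c) f (normc c) 0) => u _; rewrite expr0 mulr1.
Qed.

Lemma exp_decayD f g : exp_decay f -> exp_decay g ->
  exp_decay (fun u => f u + g u).
Proof.
move=> [C [d [C0 d0 fb]]] [C' [d' [C'0 d'0 gb]]].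
exists (C + C'), (Num.min d d'); split.
- exact: addr_ge0.
- by rewrite lt_min d0.
move=> u u0; apply: le_trans (le_normcD _ _) _; rewrite mulrDl; apply: lerD.
  apply: le_trans (fb u u0) _; rewrite ler_wpM2l // ler_expR lerN2 ler_wpM2r //.
  by rewrite ge_min lexx.
apply: le_trans (gb u u0) _; rewrite ler_wpM2l // ler_expR lerN2 ler_wpM2r //.
by rewrite ge_min lexx orbT.
Qed.

End HalfLine.

(** * Turning the ray of a Gaussian integral *)

Section Contour.
Context {R : realType}.
Implicit Types (z : R[i]).

Lemma is_cderive_quad (A B D : R[i]) (u : R) :
  is_cderive (fun u : R => A + B * u%:C%C + D * u%:C%C ^+ 2) u
             (B + 2 * D * u%:C%C).
Proof.
have id1 : is_cderive (fun u : R => u%:C%C) u 1.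
  by apply: is_cderive_real; exact: is_derive_id.
apply: is_cderive_eq (is_cderiveD (is_cderiveD (is_cderive_cst u A)
  (is_cderiveM (is_cderive_cst u B) id1))
  (is_cderiveM (is_cderive_cst u D) (is_cderiveM id1 id1))) _.
by ring.
Qed.

(** For the direction [v (1 - i s)] the left-hand side is the part depending on
    [v] of the real part of [- (z + v (1 - i s))^2].  Since
    [Re z + s Im z = (1 - s) Re z + s (Re z + Im z)], it is at most
    [(1 - s) (- 2 v Re z - v^2) - 2 s v (Re z + Im z)]: the quadratic term
    fades as [s] tends to [1], but only in the same proportion as the
    possibly harmful [Re z].  The resulting bound does not depend on [s]. *)
Lemma gauss_exponent_le (z : R[i]) (s v : R) :
  0 <= s <= 1 -> 0 <= v -> 0 < Re z + Im z ->
  - (2 * v * (Re z + s * Im z)) - v ^+ 2 * (1 - s ^+ 2)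
  <= (`|Re z| + (Re z + Im z)) ^+ 2 - 2 * (Re z + Im z) * v.
Proof.
move=> /andP[s0 s1] v0; move: (Re z) (Im z) => X Y d0.
have XE : - X <= `|X| by rewrite -normrN ler_norm.
have X0 := normr_ge0 X.
set N := `|X| in XE X0 *; set d := X + Y.
have YE : Y = d - X by rewrite /d; ring.
(* The quadratic term dominates the linear one up to the constant (N + d)^2. *)
have h1 : 0 <= (v - (N + d)) ^+ 2 by exact: sqr_ge0.
have h2 : - (2 * v * X) - v ^+ 2 <= (N + d) ^+ 2 - 2 * d * v.
  have : 0 <= v * (N + X) by rewrite mulr_ge0 // -lerBlDr sub0r.
  by nra.
have h3 : (1 - s) * (- (2 * v * X) - v ^+ 2) <= (1 - s) * ((N + d) ^+ 2 - 2 * d * v).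
  by rewrite ler_wpM2l // subr_ge0.
have h4 : 0 <= s * (N + d) ^+ 2 by rewrite mulr_ge0 ?sqr_ge0.
have h5 : 0 <= v ^+ 2 * (s * (1 - s)).
  by rewrite mulr_ge0 ?sqr_ge0 // mulr_ge0 // subr_ge0.
rewrite YE -subr_ge0.
have -> : (N + d) ^+ 2 - 2 * d * v -
  (- (2 * v * (X + s * (d - X))) - v ^+ 2 * (1 - s ^+ 2)) =
  ((1 - s) * ((N + d) ^+ 2 - 2 * d * v) - (1 - s) * (- (2 * v * X) - v ^+ 2))
  + s * (N + d) ^+ 2 + v ^+ 2 * (s * (1 - s)) by ring.
apply: addr_ge0 => //; apply: addr_ge0 => //.
by rewrite subr_ge0.
Qed.

Variables (z : R[i]) (lam : R).
Hypothesis lam0 : 0 < lam.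
Hypothesis z0 : 0 < Re z + Im z.

(** The squared sine runs from [0] to [1] between [0] and [pi / 2], and stays
    between [0] and [1] for all real [th]: the path of directions is thus
    defined, and the bounds hold, on the whole real line. *)
Let par (th : R) : R := sin th ^+ 2.
Let par' (th : R) : R := 2 * sin th * cos th.
(** Moving the modulus from [1] to [lam] together with the direction absorbs the
    change of variable [u -> lam u]. *)
Let len (th : R) : R := 1 + (lam - 1) * par th.
Let dir (th : R) : R[i] := (len th)%:C%C * (1 - 'i%C * (par th)%:C%C).
Let dir' (th : R) : R[i] :=
  ((lam - 1) * par' th)%:C%C * (1 - 'i%C * (par th)%:C%C)
  - (len th)%:C%C * ('i%C * (par' th)%:C%C).
Let G (th u : R) : R[i] := expc (- (z + dir th * u%:C%C) ^+ 2).
Let f (th u : R) : R[i] := dir th * G th u.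
(** The [th]-derivative of [f], which is also the [u]-derivative of
    [dir' th * u * G th u]. *)
Let f' (th u : R) : R[i] :=
  dir' th * (1 - 2 * (z + dir th * u%:C%C) * dir th * u%:C%C) * G th u.

Let par01 th : 0 <= par th <= 1.
Proof. by rewrite /par sqr_ge0 /= -(cos2Dsin2 th) lerDr sqr_ge0. Qed.

Let par'_le th : `|par' th| <= 2.
Proof.
rewrite /par' normrM normrM (ger0_norm (ler0n _ 2)) -mulrA ler_piMr //.
by rewrite mulr_ile1 // ler_norml ?sin_geN1 ?sin_le1 ?cos_geN1 ?cos_le1.
Qed.

Let minlen : R := Num.min 1 lam.

Let minlen_gt0 : 0 < minlen.
Proof. by rewrite /minlen lt_min ltr01. Qed.

Let len_ge th : minlen <= len th.
Proof.
have /andP[s0 s1] := par01 th.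
have m1 : minlen <= 1 by rewrite /minlen ge_min lexx.
have m2 : minlen <= lam by rewrite /minlen ge_min lexx orbT.
by rewrite /len; nra.
Qed.

Let is_derive_par (th : R) : is_derive th 1 par (par' th).
Proof.
rewrite /par; apply: is_derive_eq.
by rewrite /par' /GRing.scale /=; ring.
Qed.

Let is_cderive_dir th : is_cderive dir th (dir' th).
Proof.
have -> : dir = fun th => (len th)%:C%C * (1 + - 'i%C * (par th)%:C%C).
  by apply/funext => t; rewrite mulNr.
have h := is_derive_par th.
have hs := is_cderive_real h.
have hm : is_derive th 1 len ((lam - 1) * par' th).
  by rewrite /len; apply: is_derive_eq; rewrite /GRing.scale /=; ring.
apply: is_cderive_eq (is_cderiveM (is_cderive_real hm)
  (is_cderiveD (is_cderive_cst th 1)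
    (is_cderiveM (is_cderive_cst th (- 'i%C)) hs))) _.
by rewrite /dir'; ring.
Qed.

(** Uniformity in [th] is what differentiation under the integral sign requires;
    the rate stays positive because [len] is at least [minlen]. *)
Let G_le : exists K d, [/\ 0 <= K, 0 < d &
  forall th u, 0 <= u -> normc (G th u) <= K * expR (- (d * u))].
Proof.
exists (expR (- Re (z ^+ 2) + (`|Re z| + (Re z + Im z)) ^+ 2)).
exists (2 * (Re z + Im z) * minlen); split.
- exact: expR_ge0.
- by rewrite !mulr_gt0.
move=> th u u0; rewrite normc_expc -expRD ler_expR.
have v0 : 0 <= len th * u by rewrite mulr_ge0 // (le_trans (ltW minlen_gt0)).
have := gauss_exponent_le (par01 th) v0 z0.
have hv : 2 * (Re z + Im z) * (minlen * u) <= 2 * (Re z + Im z) * (len th * u).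
  by rewrite ler_wpM2l ?ler_wpM2r // mulr_ge0 // ltW.
have -> : Re (- (z + dir th * u%:C%C) ^+ 2) = - Re (z ^+ 2)
    + (- (2 * (len th * u) * (Re z + par th * Im z))
    - (len th * u) ^+ 2 * (1 - par th ^+ 2)).
  by rewrite /dir; case: (z) => X Y /=; ring.
by move: hv; rewrite !mulrA; lra.
Qed.

(** The three polynomial factors of the Gaussian are those of [f], of the
    primitive of [f'], and of [f'] itself. *)
Let coeff_le : exists A, 0 <= A /\ forall th u, 0 <= u ->
  [/\ normc (dir th) <= A * (1 + u) ^+ 2,
      normc (dir' th * u%:C%C) <= A * (1 + u) ^+ 2 &
  normc (dir' th * (1 - 2 * (z + dir th * u%:C%C) * dir th * u%:C%C))
  <= A * (1 + u) ^+ 2].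
Proof.
pose L := `|lam - 1|; pose N := normc z.
pose D := 2 * (1 + L); pose D' := D + 4 * L.
have L0 : 0 <= L by exact: normr_ge0.
have N0 : 0 <= N by exact: normc_ge0.
have D0 : 0 <= D by rewrite /D mulr_ge0 // addr_ge0.
have D'0 : 0 <= D' by rewrite /D' addr_ge0 // mulr_ge0.
have normci : normc ('i%C : R[i]) = 1 by rewrite /= expr0n expr1n add0r sqrtr1.
have parle th : `|par th| <= 1.
  by have /andP[s0 s1] := par01 th; rewrite ger0_norm.
have s2 th : normc (1 - 'i%C * (par th)%:C%C) <= 2.
  apply: le_trans (le_normcD _ _) _.
  rewrite normcN normcM normci normc_real mul1r normc1.
  by have := parle th; lra.
have lenL th : `|len th| <= 1 + L.
  apply: le_trans (ler_normD _ _) _; rewrite normr1 lerD2l normrM.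
  by rewrite ler_piMr.
have dirle th : normc (dir th) <= D.
  rewrite /dir normcM normc_real /D [leRHS]mulrC.
  by rewrite ler_pM // normc_ge0.
have dir'le th : normc (dir' th) <= D'.
  apply: le_trans (le_normcD _ _) _.
  rewrite normcN !normcM !normc_real normci mul1r.
  have h1 : `|(lam - 1) * par' th| * normc (1 - 'i%C * (par th)%:C%C) <= (L * 2) * 2.
    by rewrite ler_pM ?normc_ge0 // normrM ler_pM.
  have h2 : `|len th| * `|par' th| <= (1 + L) * 2 by rewrite ler_pM.
  by rewrite /D' /D; lra.
exists (D' * (1 + 2 * (N + D) * D)); split.
  by rewrite mulr_ge0 // addr_ge0 // !mulr_ge0 // addr_ge0.
move=> th u u0.
have P1 : 1 <= (1 + u) ^+ 2 by rewrite exprn_ege1 // lerDl.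
have uP : u <= (1 + u) ^+ 2 by nra.
have u2P : u ^+ 2 <= (1 + u) ^+ 2 by nra.
have B1 : 1 <= 1 + 2 * (N + D) * D.
  by rewrite lerDl !mulr_ge0 // addr_ge0.
have B0 : 0 <= 1 + 2 * (N + D) * D by exact: le_trans B1.
have nu : normc (u%:C%C : R[i]) = u by rewrite normc_real ger0_norm.
have n2 : normc (2 : R[i]) = 2.
  by rewrite (_ : 2 = (2 : R)%:C%C) ?normc_real ?ger0_norm // rmorph_nat.
split.
- apply: le_trans (dirle th) _; apply: (@le_trans _ _ D').
    by rewrite /D' lerDl mulr_ge0.
  by rewrite -[leRHS]mulrA ler_peMr // mulr_ege1.
- rewrite normcM nu -[leRHS]mulrA; apply: ler_pM => //; first exact: normc_ge0.
  by apply: le_trans uP _; rewrite ler_peMl // sqr_ge0.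
- rewrite normcM -[leRHS]mulrA; apply: ler_pM => //; [exact: normc_ge0..|].
  apply: le_trans (le_normcD _ _) _.
  rewrite normcN normcM normcM normcM normc1 nu n2.
  have h1 : normc (z + dir th * u%:C%C) <= N + D * u.
    apply: le_trans (le_normcD _ _) _; rewrite lerD2l normcM nu.
    by rewrite ler_wpM2r.
  have h2 : 2 * normc (z + dir th * u%:C%C) * normc (dir th) * u
      <= 2 * (N + D * u) * D * u.
    rewrite ler_wpM2r // ler_pM ?mulr_ge0 ?normc_ge0 //.
    by rewrite ler_wpM2l.
  have h3 : N * D * u <= N * D * (1 + u) ^+ 2 by rewrite ler_wpM2l // mulr_ge0.
  have h4 : D * D * u ^+ 2 <= D * D * (1 + u) ^+ 2.
    by rewrite ler_wpM2l // mulr_ge0.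
  apply: (@le_trans _ _ (1 + 2 * (N + D * u) * D * u)).
    by rewrite lerD2l.
  have -> : 1 + 2 * (N + D * u) * D * u = 1 + 2 * (N * D * u) + 2 * (D * D * u ^+ 2).
    by ring.
  have -> : (1 + 2 * (N + D) * D) * (1 + u) ^+ 2 = (1 + u) ^+ 2
    + 2 * (N * D * (1 + u) ^+ 2) + 2 * (D * D * (1 + u) ^+ 2) by ring.
  by rewrite !lerD // ler_wpM2l.
Qed.

Let is_cderive_f th u : is_cderive (f ^~ u) th (f' th u).
Proof.
have hd := is_cderive_dir th.
have hq : is_cderive (fun t => z + dir t * u%:C%C) th (dir' th * u%:C%C).
  apply: is_cderive_eq (is_cderiveD (is_cderive_cst th z)
    (is_cderiveM hd (is_cderive_cst th u%:C%C))) _.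
  by ring.
have hG := is_cderive_expc (is_cderiveM (is_cderive_cst th (-1))
  (is_cderiveM hq hq)).
have -> : f ^~ u = fun t => dir t * expc (-1 * ((z + dir t * u%:C%C) * (z + dir t * u%:C%C))).
  by apply/funext => t; rewrite /f /G mulN1r expr2.
apply: is_cderive_eq (is_cderiveM hd hG) _.
rewrite /f' /G mulN1r -expr2; ring.
Qed.

Let is_cderive_G th u :
  is_cderive (G th) u (- 2 * (z + dir th * u%:C%C) * dir th * G th u).
Proof.
have -> : G th = fun u => expc (- z ^+ 2 + - (2 * z * dir th) * u%:C%C
                               + - dir th ^+ 2 * u%:C%C ^+ 2).
  by apply/funext => v; rewrite /G; congr expc; ring.
apply: is_cderive_eq (is_cderive_expc (is_cderive_quad _ _ _ u)) _.
by congr (_ * expc _); ring.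
Qed.

Let G_decay th : exp_decay (G th).
Proof.
have [K [d [K0 d0 GK]]] := G_le.
by exists K, d; split=> // u u0; exact: GK.
Qed.

Let integral_f' th : cintegral0y (f' th) = 0.
Proof.
have [A [A0 HA]] := coeff_le.
have -> : 0 = - (dir' th * 0%:C%C * G th 0) by rewrite rmorph0 mulr0 mul0r oppr0.
apply: (@cintegral0y_FTC _ (f' th) (fun u => dir' th * u%:C%C * G th u)).
- have Ef : f' th = fun u => (dir' th + - (2 * z * dir th * dir' th) * u%:C%C
      + - (2 * dir th ^+ 2 * dir' th) * u%:C%C ^+ 2) * G th u.
    by apply/funext => u; rewrite /f'; ring.
  rewrite Ef; apply: is_cderive_ccontinuous => u.
  exact: is_cderiveM (is_cderive_quad _ _ _ u) (is_cderive_G th u).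
- by apply: (@exp_decayM _ _ _ A 2 _ (G_decay th)) => u u0; have [] := HA th u u0.
- by apply: (@exp_decayM _ _ _ A 2 _ (G_decay th)) => u u0; have [] := HA th u u0.
- move=> u; apply: is_cderive_eq (is_cderiveM (is_cderiveM (is_cderive_cst u (dir' th))
    (is_cderive_real (is_derive_id u 1))) (is_cderive_G th u)) _.
  by rewrite /f' /=; ring.
Qed.

Let f_integrable th : cintegrable (f th).
Proof.
have [A [A0 HA]] := coeff_le.
apply: exp_decay_cintegrable.
  apply: is_cderive_ccontinuous => u.
  exact: is_cderiveM (is_cderive_cst u (dir th)) (is_cderive_G th u).
by apply: (@exp_decayM _ _ _ A 2 _ (G_decay th)) => u u0; have [] := HA th u u0.
Qed.

(** The direction at parameter [0] is [1], at [pi / 2] it is [lam (1 - i)]. *)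
Lemma cintegral0y_gauss_turn :
  cintegral0y (fun u => expc (- (z + u%:C%C) ^+ 2))
  = lam%:C%C * (1 - 'i%C)
    * cintegral0y (fun u => expc (- (z + lam%:C%C * (1 - 'i%C) * u%:C%C) ^+ 2)).
Proof.
have [A [A0 HA]] := coeff_le.
have [K [d [K0 d0 GK]]] := G_le.
have d20 : 0 < d / 2 by rewrite divr_gt0.
have [C [C0 HC]] := expR_dominates_pow 2 d20.
have KAC0 : 0 <= A * C * K by rewrite !mulr_ge0.
have f'b th u : 0 <= u -> normc (f' th u) <= A * C * K * expR (- (d / 2 * u)).
  move=> u0; have [_ _ h] := HA th u u0.
  rewrite /f' normcM.
  apply: le_trans (ler_pM (normc_ge0 _) (normc_ge0 _) h (GK th u u0)) _.
  have -> : expR (- (d / 2 * u)) = expR (d / 2 * u) * expR (- (d * u)).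
    by rewrite -expRD; congr expR; field.
  have -> : A * C * K * (expR (d / 2 * u) * expR (- (d * u)))
    = A * (C * expR (d / 2 * u)) * (K * expR (- (d * u))) by ring.
  rewrite ler_wpM2r ?mulr_ge0 ?expR_ge0 // ler_wpM2l //; exact: HC.
have := cintegral0y_param_const KAC0 d20 f_integrable is_cderive_f f'b integral_f' 0 (pi / 2).
have par0 : par 0 = 0 by rewrite /par sin0 expr0n.
have par1 : par (pi / 2) = 1 by rewrite /par sin_pihalf expr1n.
have -> : f 0 = fun u => expc (- (z + u%:C%C) ^+ 2).
  apply/funext => u; rewrite /f /G /dir /len par0 mulr0 addr0 rmorph0 mulr0 subr0.
  by rewrite !mul1r.
move=> ->.
have dE : dir (pi / 2) = lam%:C%C * (1 - 'i%C).
  by rewrite /dir /len par1 rmorph1 !mulr1 subrKC.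
have Gi : cintegrable (G (pi / 2)).
  apply: exp_decay_cintegrable (G_decay _).
  by apply: is_cderive_ccontinuous => u; exact: is_cderive_G.
by rewrite /f (cintegral0yZ _ Gi) /G dE.
Qed.

End Contour.

(** * Laguerre polynomials *)

Section Laguerre.
Context {R : realType}.

Lemma coef_laguerre n k :
  (laguerre R n)`_k = (-1) ^+ k * 'C(n, k)%:R / k`!%:R.
Proof.
rewrite coef_poly; case: ltnP => // nk.
by rewrite bin_small // mulr0 mul0r.
Qed.

Lemma laguerre_deriv n : (laguerre R n.+1)^`() - (laguerre R n)^`() = - laguerre R n.
Proof.
apply/polyP => k; rewrite coefB coefN !coef_deriv -mulrnBl -mulr_natr !coef_laguerre.
rewrite binS natrD factS natrM exprS.
have k1 : k.+1%:R != 0 :> R by rewrite pnatr_eq0.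
have kf : k`!%:R != 0 :> R by rewrite pnatr_eq0 -lt0n fact_gt0.
by field; rewrite kf nat1r k1.
Qed.

(** At [n = 0] the truncated predecessor comes with the coefficient [0]. *)
Lemma laguerre_rec n :
  n.+1%:R *: laguerre R n.+1
  = (2 * n%:R + 1) *: laguerre R n - 'X * laguerre R n - n%:R *: laguerre R n.-1.
Proof.
apply/polyP => k; rewrite !(coefB, coefZ, coefXM) !coef_laguerre.
case: k => [|k]; first by rewrite /= !bin0 !expr0 fact0 divr1 !mulr1 -natr1; ring.
rewrite /= binS natrD factS natrM exprS.
have k1 : k.+1%:R != 0 :> R by rewrite pnatr_eq0.
have kf : k`!%:R != 0 :> R by rewrite pnatr_eq0 -lt0n fact_gt0.
have sub_bin j : (n - j)%:R * 'C(n, j)%:R = (n%:R - j%:R) * 'C(n, j)%:R :> R.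
  have [jn|nj] := leqP j n; first by rewrite natrB.
  by rewrite bin_small // !mulr0.
have H1 : n%:R * 'C(n.-1, k.+1)%:R = (n%:R - k.+1%:R) * 'C(n, k.+1)%:R :> R.
  by rewrite -sub_bin -!natrM mul_bin_down.
have H2 : k.+1%:R * 'C(n, k.+1)%:R = (n%:R - k%:R) * 'C(n, k)%:R :> R.
  by rewrite -sub_bin -!natrM mul_bin_left.
have -> : n%:R * (-1 * (-1) ^+ k * 'C(n.-1, k.+1)%:R / (k.+1%:R * k`!%:R))
    = - (-1) ^+ k * (n%:R * 'C(n.-1, k.+1)%:R) / (k.+1%:R * k`!%:R) :> R.
  by field; rewrite kf nat1r k1.
rewrite H1.
move: H2 k1; rewrite -!natr1 => H2 k1.
apply/eqP; rewrite -subr_eq0; apply/eqP.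
transitivity ((-1) ^+ k * ((k%:R + 1) * 'C(n, k.+1)%:R - (n%:R - k%:R) * 'C(n, k)%:R)
  / ((k%:R + 1) * k`!%:R) : R); first by field; rewrite kf k1.
by rewrite H2 subrr mulr0 mul0r.
Qed.

(** The three-term recurrence at [n.+1] minus the one at [n]: the multiples of
    ['X] then combine into the difference [L_{n+1} - L_n], whose value at [0]
    is zero and whose derivative is [- L_n]. *)
Lemma laguerre_rec4 n :
  n.+2%:R *: laguerre R n.+2 - (3 * n.+1%:R + 1) *: laguerre R n.+1
  + (3 * n.+1%:R - 1) *: laguerre R n - n%:R *: laguerre R n.-1
  = - ('X * (laguerre R n.+1 - laguerre R n)).
Proof.
rewrite laguerre_rec /=.
have -> : n%:R *: laguerre R n.-1 = (2 * n%:R + 1) *: laguerre R n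
    - 'X * laguerre R n - n.+1%:R *: laguerre R n.+1.
  by rewrite laguerre_rec; ring.
rewrite -!mul_polyC -natr1 !(rmorphD, rmorphM, rmorphB, rmorphN, rmorph1, rmorph_nat).
ring.
Qed.

End Laguerre.

(** * Integration by parts against the evolution kernel *)

Section Evolution.
Context {R : realType}.
Variables (a x : R).

(** The frequency kernel of [psi] with [a] in place of [eps * t], so that [a = 0]
    covers the initial time. *)
Definition evol (u : R) : R[i] :=
  expc (- (u / 2)%:C%C + 'i%C * (a * u ^+ 2)%:C%C + 'i%C * (x * u)%:C%C).

Let b : R[i] := 'i%C * x%:C%C - 2^-1%:C%C.

Lemma evolE u : evol u = expc (0 + b * u%:C%C + 'i%C * a%:C%C * u%:C%C ^+ 2).
Proof.
rewrite /evol; congr expc; rewrite /b !rmorphM /=.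
ring.
Qed.

Lemma is_cderive_evol u :
  is_cderive evol u ((b + 2 * 'i%C * a%:C%C * u%:C%C) * evol u).
Proof.
rewrite (_ : evol = fun u => expc (0 + b * u%:C%C + 'i%C * a%:C%C * u%:C%C ^+ 2)).
  apply: is_cderive_eq (is_cderive_expc (is_cderive_quad _ _ _ u)) _.
  by congr (_ * _); ring.
by apply/funext => v; exact: evolE.
Qed.

Lemma evol_decay : exp_decay evol.
Proof.
exists 1, 2^-1; split=> // u u0.
rewrite normc_expc mul1r ler_expR /= le_eqVlt; apply/orP; left; apply/eqP.
by ring.
Qed.

Lemma poly_bound (p : {poly R}) : exists A k, forall u, 0 <= u ->
  normc (p.[u]%:C%C) <= A * (1 + u) ^+ k.
Proof.
elim/poly_ind: p => [|p c [A [k IH]]].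
  by exists 0, 0 => u u0; rewrite horner0 normc_real normr0 mul0r.
exists (A + `|c|), k.+1 => u u0; have := IH u u0.
rewrite !normc_real hornerMXaddC => pA.
have h1 : 1 <= (1 + u) ^+ k.+1 by rewrite exprn_ege1 // lerDl.
apply: le_trans (ler_normD _ _) _; rewrite mulrDl; apply: lerD; last first.
  by rewrite ler_peMr.
rewrite normrM (ger0_norm u0) exprSr mulrA; apply: ler_pM => //.
by rewrite lerDr.
Qed.

(** The frequency integral of [psi], with a polynomial [p] in place of the
    Laguerre polynomial, so that linearity in [p] can be used. *)
Definition evol_int (p : {poly R}) : R[i] :=
  cintegral0y (fun u => p.[u]%:C%C * evol u).

Let is_cderive_pevol (p : {poly R}) u : is_cderive (fun u => p.[u]%:C%C * evol u) u
  (p^`().[u]%:C%C * evol u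
    + p.[u]%:C%C * ((b + 2 * 'i%C * a%:C%C * u%:C%C) * evol u)).
Proof.
exact: is_cderiveM (is_cderive_real (is_derive_poly p u)) (is_cderive_evol u).
Qed.

Let pevol_decay (p : {poly R}) : exp_decay (fun u => p.[u]%:C%C * evol u).
Proof.
by have [A [k pA]] := poly_bound p; exact: exp_decayM pA evol_decay.
Qed.

Let pevol_continuous (p : {poly R}) : ccontinuous (fun u => p.[u]%:C%C * evol u).
Proof. exact: is_cderive_ccontinuous (is_cderive_pevol p). Qed.

Lemma evol_poly_integrable (p : {poly R}) : cintegrable (fun u => p.[u]%:C%C * evol u).
Proof. exact: exp_decay_cintegrable. Qed.

Lemma evol_intD p q : evol_int (p + q) = evol_int p + evol_int q.
Proof.
rewrite /evol_int -cintegral0yD; [|exact: evol_poly_integrable..].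
apply: eq_cintegral0y => u.
by rewrite hornerD rmorphD mulrDl.
Qed.

Lemma evol_intZ c p : evol_int (c *: p) = c%:C%C * evol_int p.
Proof.
rewrite /evol_int -cintegral0yZ; last exact: evol_poly_integrable.
apply: eq_cintegral0y => u.
by rewrite hornerZ rmorphM mulrA.
Qed.

Lemma evol_intN p : evol_int (- p) = - evol_int p.
Proof. by rewrite -scaleN1r evol_intZ rmorphN rmorph1 mulN1r. Qed.

(** The integrand on the left is the derivative of [p * evol], whose value at
    [0] is [p(0)] and which vanishes at infinity. *)
Lemma evol_int_parts (p : {poly R}) :
  evol_int p^`() + b * evol_int p + 2 * 'i%C * a%:C%C * evol_int ('X * p)
  = - p.[0]%:C%C.
Proof.
have E0 : evol 0 = 1.
  by rewrite evolE rmorph0 expr0n /= !mulr0 !addr0 expc0.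
have -> : - p.[0]%:C%C = - (p.[0]%:C%C * evol 0) by rewrite E0 mulr1.
pose g u := (p^`().[u]%:C%C * evol u + b * (p.[u]%:C%C * evol u))
  + 2 * 'i%C * a%:C%C * (('X * p).[u]%:C%C * evol u).
have gE u : g u = p^`().[u]%:C%C * evol u
    + p.[u]%:C%C * ((b + 2 * 'i%C * a%:C%C * u%:C%C) * evol u).
  by rewrite /g hornerM hornerX rmorphM /=; ring.
have c1 (c : R[i]) q : ccontinuous (fun u => c * (q.[u]%:C%C * evol u)).
  apply: is_cderive_ccontinuous => u.
  exact: is_cderiveM (is_cderive_cst u c) (is_cderive_pevol q u).
have i1 (c : R[i]) q : cintegrable (fun u => c * (q.[u]%:C%C * evol u)).
  by apply: exp_decay_cintegrable => //; exact: exp_decayZ.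
have c2 : ccontinuous (fun u => p^`().[u]%:C%C * evol u + b * (p.[u]%:C%C * evol u)).
  apply: is_cderive_ccontinuous => u.
  exact: is_cderiveD (is_cderive_pevol _ u)
    (is_cderiveM (is_cderive_cst u b) (is_cderive_pevol p u)).
have d2 : exp_decay (fun u => p^`().[u]%:C%C * evol u + b * (p.[u]%:C%C * evol u)).
  by apply: exp_decayD => //; exact: exp_decayZ.
rewrite /evol_int -!cintegral0yZ; [|exact: evol_poly_integrable..].
rewrite -cintegral0yD //; last exact: evol_poly_integrable.
rewrite -cintegral0yD //; last exact: exp_decay_cintegrable.
apply: (@cintegral0y_FTC _ g (fun u => p.[u]%:C%C * evol u)) => //.
- apply: is_cderive_ccontinuous => u.
  exact: is_cderiveD (is_cderiveD (is_cderive_pevol _ u)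
    (is_cderiveM (is_cderive_cst u b) (is_cderive_pevol p u)))
    (is_cderiveM (is_cderive_cst u (2 * 'i%C * a%:C%C)) (is_cderive_pevol _ u)).
- by apply: exp_decayD => //; exact: exp_decayZ.
- by move=> u; rewrite gE; exact: is_cderive_pevol.
Qed.

End Evolution.

(** * The three formulas *)

Section Psi.
Context {R : realType}.

Lemma psiE (eps x t : R) n : psi eps n x t =
  (- 'i%C) ^+ n / (Num.sqrt (2 * pi))%:C%C * evol_int (eps * t) x (laguerre R n).
Proof. by []. Qed.

Lemma laguerre0 : laguerre R 0 = 1.
Proof.
apply/polyP => k; rewrite coef_laguerre coef1; case: k => [|k].
  by rewrite expr0 bin0 fact0 divr1 mulr1.
by rewrite bin0n mulr0 mul0r.
Qed.

Lemma laguerre1 : laguerre R 1 = 1 - 'X.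
Proof.
have := laguerre_rec (R := R) 0; rewrite laguerre0 scale1r scale0r subr0 => ->.
by rewrite mulr0 add0r scale1r mulr1.
Qed.

(** Integration by parts with [p = 1] determines [int u E] from [int E]; at time
    [0] the term in [a] disappears and [b int E = -1], which allows replacing
    the boundary term by [psi eps 0 x 0]. *)
Lemma psi1_rec (eps x t : R) : 0 < eps * t ->
  psi eps 1 x t =
        - 'i%C * psi eps 0 x t
        + (1 - 2 * 'i%C * x%:C%C) * ((psi eps 0 x t - psi eps 0 x 0)
                                     / (4 * eps * t)%:C%C).
Proof.
move=> a0; rewrite !psiE laguerre0 laguerre1 mulr0 expr0 expr1.
have P0 := evol_int_parts 0 x 1.
have Pa := evol_int_parts (eps * t) x 1.
rewrite evol_intD evol_intN; move: P0 Pa.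
rewrite derivC mulr1 hornerC rmorph0 rmorph1 mulr0 mul0r addr0.
have ev0 b : evol_int b x 0 = 0 by rewrite -(scale0r 0) evol_intZ rmorph0 mul0r.
rewrite !ev0 !add0r.
set c : R[i] := (Num.sqrt (2 * pi))%:C%C.
move: (evol_int 0 x 1) (evol_int (eps * t) x 1) (evol_int (eps * t) x 'X).
move=> I0 I1 IX P0 Pa.
have an0 : (eps * t)%:C%C != 0 :> R[i] by rewrite (inj_eq (@complexI R)) gt_eqF.
have -> : (4 * eps * t)%:C%C = 4 * (eps * t)%:C%C :> R[i].
  by rewrite -mulrA rmorphM rmorph_nat.
have c0 : c != 0.
  by rewrite /c (inj_eq (@complexI R)) gt_eqF // sqrtr_gt0 mulr_gt0 // pi_gt0.
move: ((eps * t)%:C%C) an0 Pa => A an0 Pa.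
have half : 2^-1%:C%C = 2^-1 :> R[i] by rewrite fmorphV rmorph_nat.
rewrite half in P0 Pa.
have core : (1 - 2 * 'i%C * x%:C%C) * (I1 - I0) = 4 * A * 'i%C * IX.
  have -> : (1 - 2 * 'i%C * x%:C%C) * (I1 - I0)
      = - 2 * (('i%C * x%:C%C - 2^-1) * I1) + 2 * (('i%C * x%:C%C - 2^-1) * I0).
    by field.
  rewrite P0; move/eqP: Pa; rewrite addrC -subr_eq0 opprK => /eqP Pa.
  transitivity (4 * A * 'i%C * IX - 2 * (2 * 'i%C * A * IX
     + ('i%C * x%:C%C - 2^-1) * I1 + 1)); first by field.
  by rewrite Pa mulr0 subr0.
transitivity (- 'i%C / c * I1 + (4 * A * 'i%C * IX) / (4 * A * c)).
  by field; rewrite an0 c0.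
rewrite -core; by field; rewrite an0 c0.
Qed.

(** Integration by parts with [p = L_n - L_{n-1}] evaluates the integral of
    [u p E], and [laguerre_rec4] computes it in a second way. *)
Lemma psi_rec (eps x t : R) (n : nat) : 0 < eps * t -> (1 <= n)%N ->
        'i%C * n.+1%:R * psi eps n.+1 x t =
          (3 * n%:R + 1 + ((2 * x)%:C%C + 'i%C) / (4 * eps * t)%:C%C)
            * psi eps n x t
          + 'i%C * (3 * n%:R - 1 + ((2 * x)%:C%C - 'i%C) / (4 * eps * t)%:C%C)
            * psi eps (n - 1) x t
          - (n%:R - 1) * psi eps (n - 2) x t.
Proof.
case: n => // n a0 _.
rewrite !psiE; rewrite subSS subn0 (_ : n.+1 - 2 = n.-1)%N; last by rewrite subSS subn1.
have Pa := evol_int_parts (eps * t) x (laguerre R n.+1 - laguerre R n).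
have Pr := congr1 (evol_int (eps * t) x) (laguerre_rec4 (R := R) n).
move: Pa Pr; rewrite derivB laguerre_deriv hornerD hornerN !laguerre_at0.
rewrite subrr rmorph0 oppr0 !(evol_intD, evol_intN, evol_intZ).
set c : R[i] := (Num.sqrt (2 * pi))%:C%C.
have an0 : (eps * t)%:C%C != 0 :> R[i] by rewrite (inj_eq (@complexI R)) gt_eqF.
have i2 : 'i%C * 'i%C = -1 :> R[i] by rewrite -expr2 sqr_i.
have -> : (4 * eps * t)%:C%C = 4 * (eps * t)%:C%C :> R[i].
  by rewrite -mulrA rmorphM rmorph_nat.
have -> : (2 * x)%:C%C = 2 * x%:C%C :> R[i] by rewrite rmorphM rmorph_nat.
have half : 2^-1%:C%C = 2^-1 :> R[i] by rewrite fmorphV rmorph_nat.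
have c0 : c != 0.
  by rewrite /c (inj_eq (@complexI R)) gt_eqF // sqrtr_gt0 mulr_gt0 // pi_gt0.
(* At n = 0 the exponent n.-1 is truncated, and both sides vanish. *)
have Epred : n%:R * (- 'i%C) ^+ n.-1 = n%:R * ('i%C * (- 'i%C) ^+ n) :> R[i].
  case: (n) => [|k]; first by rewrite !mul0r.
  by rewrite /= exprS (mulrA 'i%C) mulrN i2 opprK mul1r.
rewrite half.
move: (evol_int _ _ (laguerre R n.+2)) (evol_int _ _ (laguerre R n.+1))
 (evol_int _ _ (laguerre R n)) (evol_int _ _ (laguerre R n.-1)).
move=> J2 J1 J0 Jm.
move: (evol_int (eps * t) x _) => W Pa Pr.
have nS : n.+1%:R = n%:R + 1 :> R[i] by rewrite natr1.
have nSS : n.+2%:R = n%:R + 1 + 1 :> R[i] by rewrite !natr1.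
have C1 : (3 * n.+1%:R + 1)%:C%C = 3 * (n%:R + 1) + 1 :> R[i].
  by rewrite rmorphD rmorphM !rmorph_nat rmorph1 natr1.
have C2 : (3 * n.+1%:R - 1)%:C%C = 3 * (n%:R + 1) - 1 :> R[i].
  by rewrite rmorphB rmorphM !rmorph_nat rmorph1 natr1.
rewrite C1 C2 !rmorph_nat nSS in Pr.
rewrite nS nSS.
move: ((eps * t)%:C%C) an0 Pa => A an0 Pa.
(* Integration by parts multiplied by 2 i, which makes 4 a the coefficient
   of W. *)
have W4 : - (4 * A * W) = (2 * x%:C%C + 'i%C) * J1 - (2 * x%:C%C - 'i%C) * J0.
  have : 2 * 'i%C * (- J0 + ('i%C * x%:C%C - 2^-1) * (J1 - J0)
    + 2 * 'i%C * A * W) = 0 by rewrite Pa mulr0.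
  have -> : 2 * 'i%C * (- J0 + ('i%C * x%:C%C - 2^-1) * (J1 - J0)
    + 2 * 'i%C * A * W) = - 2 * 'i%C * J0
      + ('i%C * 'i%C * x%:C%C * 2 - 'i%C) * (J1 - J0)
      + 4 * ('i%C * 'i%C) * A * W by field.
  rewrite i2 => h; apply/eqP; rewrite -subr_eq0; apply/eqP; rewrite -[RHS]h.
  by ring.
have WE : - W = ((2 * x%:C%C + 'i%C) * J1 - (2 * x%:C%C - 'i%C) * J0) / (4 * A).
  by rewrite -W4; field.
rewrite WE in Pr.
have J2E : (n%:R + 1 + 1) * J2 = (3 * (n%:R + 1) + 1) * J1
    - (3 * (n%:R + 1) - 1) * J0 + n%:R * Jm
    + ((2 * x%:C%C + 'i%C) * J1 - (2 * x%:C%C - 'i%C) * J0) / (4 * A).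
  by rewrite -Pr; ring.
rewrite addrK !exprS.
have -> : n%:R * ((- 'i%C) ^+ n.-1 / c * Jm) = n%:R * ('i%C * (- 'i%C) ^+ n) / c * Jm.
  by rewrite -Epred; ring.
have -> : 'i%C * (n%:R + 1 + 1) * (- 'i%C * (- 'i%C * (- 'i%C) ^+ n) / c * J2)
   = ('i%C * 'i%C) * 'i%C * (- 'i%C) ^+ n / c * ((n%:R + 1 + 1) * J2) by ring.
rewrite J2E i2.
by field; rewrite an0 c0.
Qed.

(** With [r = sqrt (8 a)], the square root in the argument [z] of [erfc] is
    [r (1 + i)], and completing the square in [evol] gives the direction
    [w = (r / 4) (1 - i)], because [w^2 = - i a].  The turning lemma applies
    since [Re z + Im z = 1 / r]. *)
Lemma evol_int_erfc (a x : R) : 0 < a ->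
  1 / (Num.sqrt (2 * pi))%:C%C * evol_int a x 1 =
  sqrtc ('i%C / (8 * a)%:C%C)
  * expc (((2 * x)%:C%C + 'i%C) ^+ 2 / (16 * 'i%C * a%:C%C))
  * erfc (((2 * x)%:C%C + 'i%C) / sqrtc (16 * 'i%C * a%:C%C)).
Proof.
move=> a0.
set r := Num.sqrt (8 * a).
have r0 : 0 < r by rewrite sqrtr_gt0 mulr_gt0.
have r2 : r ^+ 2 = 8 * a by rewrite sqr_sqrtr // mulr_ge0 // ltW.
have i2 : 'i%C * 'i%C = -1 :> R[i] by rewrite -expr2 sqr_i.
have S16 : sqrtc (16 * 'i%C * a%:C%C) = r%:C%C * (1 + 'i%C).
  have -> : 16 * 'i%C * a%:C%C = (16 * a)%:C%C * 'i%C :> R[i].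
    by rewrite rmorphM rmorph_nat; ring.
  rewrite sqrtc_imag ?mulr_ge0 ?ltW //; congr (_%:C%C * _); congr Num.sqrt.
  by field.
have S8 : sqrtc ('i%C / (8 * a)%:C%C) = (Num.sqrt 2 * r)^-1%:C%C * (1 + 'i%C).
  have -> : 'i%C / (8 * a)%:C%C = (8 * a)^-1%:C%C * 'i%C :> R[i].
    by rewrite fmorphV mulrC.
  rewrite sqrtc_imag ?invr_ge0 ?mulr_ge0 ?ltW //; congr (_%:C%C * _).
  by rewrite -sqrtrM // -sqrtrV ?mulr_ge0 ?ltW // -invfM mulrC.
rewrite S16 S8.
set z : R[i] := _ / (r%:C%C * _).
have rn0 : r%:C%C != 0 :> R[i] by rewrite (inj_eq (@complexI R)) gt_eqF.
have in0 : 1 + 'i%C != 0 :> R[i].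
  by rewrite eq_complex /= addr0 oner_eq0.
have zE : z = ((2 * x + 1) / (2 * r))%:C%C + ((1 - 2 * x) / (2 * r))%:C%C * 'i%C.
  apply: (mulIf (mulf_neq0 rn0 in0)); rewrite /z divfK ?mulf_neq0 //.
  apply: complex_eqP; rewrite !(cReM, cImM, cReD, cImD) /=; field; rewrite gt_eqF //.
have z0 : 0 < Re z + Im z.
  rewrite zE /=.
  set y := (X in 0 < X); have -> : y = r^-1 by rewrite /y; field; rewrite gt_eqF.
  by rewrite invr_gt0.
have lam0 : 0 < r / 4 by rewrite divr_gt0.
rewrite /erfc (cintegral0y_gauss_turn lam0 z0).
set w : R[i] := (r / 4)%:C%C * (1 - 'i%C).
have half : 2^-1%:C%C = 2^-1 :> R[i] by rewrite fmorphV rmorph_nat.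
have wE : w ^+ 2 = - ('i%C * a%:C%C).
  have -> : w ^+ 2 = (r ^+ 2 / 16)%:C%C * (1 - 2 * 'i%C + 'i%C * 'i%C).
    rewrite /w (_ : r ^+ 2 / 16 = (r / 4) * (r / 4)); last by field.
    by rewrite rmorphM; ring.
  rewrite i2 r2 (_ : 8 * a / 16 = 2^-1 * a); last by field.
  by rewrite rmorphM /= half; field.
have zwE : 2 * z * w = 2^-1%:C%C - 'i%C * x%:C%C.
  have i3 : (1 - 'i%C) / (1 + 'i%C) = - 'i%C :> R[i].
    by apply: (mulIf in0); rewrite divfK // mulrDr mulr1 mulNr i2; ring.
  have -> : 2 * z * w = ((2 * x)%:C%C + 'i%C) / 2 * ((1 - 'i%C) / (1 + 'i%C)).
    have r4 : (r / 4)%:C%C = r%:C%C / 4 :> R[i].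
      by rewrite rmorphM fmorphV rmorph_nat.
    rewrite /z /w r4; field.
    by rewrite in0 rn0.
  rewrite i3 half (_ : (2 * x)%:C%C = 2 * x%:C%C); last first.
    by rewrite rmorphM rmorph_nat.
  transitivity (- ('i%C * x%:C%C) - ('i%C * 'i%C) / 2 : R[i]); first by field.
  by rewrite i2; field.
have z2E : ((2 * x)%:C%C + 'i%C) ^+ 2 / (16 * 'i%C * a%:C%C) = z ^+ 2.
  rewrite /z expr_div_n exprMn -rmorphXn /= r2 rmorphM rmorph_nat.
  congr (_ / _).
  transitivity (8 * a%:C%C * (1 + 2 * 'i%C + 'i%C * 'i%C) : R[i]); last by ring.
  by rewrite i2; ring.
have -> : cintegral0y (fun u : R => expc (- (z + w * u%:C%C) ^+ 2))
    = expc (- z ^+ 2) * evol_int a x 1.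
  rewrite /evol_int -cintegral0yZ; last exact: evol_poly_integrable.
  apply: eq_cintegral0y => u; rewrite hornerC rmorph1 mul1r evolE -expcD.
  congr expc.
  transitivity (- z ^+ 2 - 2 * z * w * u%:C%C - w ^+ 2 * u%:C%C ^+ 2); first by ring.
  by rewrite zwE wE; ring.
rewrite z2E.
have ez : expc (z ^+ 2) * expc (- z ^+ 2) = 1 by rewrite -expcD subrr expc0.
transitivity (((Num.sqrt 2 * r)^-1 * (2 / Num.sqrt pi) * (r / 4))%:C%C
    * (1 - 'i%C * 'i%C) * (expc (z ^+ 2) * expc (- z ^+ 2)) * evol_int a x 1).
  rewrite i2 opprK ez mulr1; congr (_ * _).
  rewrite (_ : 1 + 1 = 2%:C%C); last by rewrite rmorph_nat.
  rewrite -rmorphM div1r -fmorphV.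
  rewrite sqrtrM //; congr (_%:C%C); field.
  by rewrite (gt_eqF r0) !gt_eqF ?sqrtr_gt0 ?pi_gt0.
rewrite /w; move: (expc _) (expc _) (evol_int _ _ _) => e1 e2 I.
rewrite !rmorphM; ring.
Qed.

Lemma psi0_erfc (eps x t : R) : 0 < eps -> 0 < t ->
  psi eps 0 x t =
        sqrtc ('i%C / (8 * eps * t)%:C%C)
        * expc (((2 * x)%:C%C + 'i%C) ^+ 2 / (16 * 'i%C * (eps * t)%:C%C))
        * erfc (((2 * x)%:C%C + 'i%C) / sqrtc (16 * 'i%C * (eps * t)%:C%C)).
Proof.
move=> eps0 t0; rewrite psiE expr0 laguerre0 -(mulrA 8 eps t).
by apply: evol_int_erfc; rewrite mulr_gt0.
Qed.

End Psi.

(* For n = 1 the truncated index n - 2 is 0 and its coefficient n - 1 vanishes. *)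
Theorem lemma7 (R : realType) (eps : R) (heps : 0 < eps)
    (x : R) (t : R) (ht : 0 < t) :
  [/\ psi eps 0 x t =
        sqrtc ('i%C / (8 * eps * t)%:C%C)
        * expc (((2 * x)%:C%C + 'i%C) ^+ 2 / (16 * 'i%C * (eps * t)%:C%C))
        * erfc (((2 * x)%:C%C + 'i%C) / sqrtc (16 * 'i%C * (eps * t)%:C%C)),
      psi eps 1 x t =
        - 'i%C * psi eps 0 x t
        + (1 - 2 * 'i%C * x%:C%C) * ((psi eps 0 x t - psi eps 0 x 0)
                                     / (4 * eps * t)%:C%C)
    & forall n : nat, (1 <= n)%N ->
        'i%C * n.+1%:R * psi eps n.+1 x t =
          (3 * n%:R + 1 + ((2 * x)%:C%C + 'i%C) / (4 * eps * t)%:C%C)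
            * psi eps n x t
          + 'i%C * (3 * n%:R - 1 + ((2 * x)%:C%C - 'i%C) / (4 * eps * t)%:C%C)
            * psi eps (n - 1) x t
          - (n%:R - 1) * psi eps (n - 2) x t].
Proof.
have a0 : 0 < eps * t by rewrite mulr_gt0.
split; [exact: psi0_erfc|exact: psi1_rec|by move=> n; exact: psi_rec].
Qed.
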